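(* Let $k$ be a unital commutative ring, $n$ a positive integer, and let $\delta\in k$ be invertible. Then there is an isomorphism of graded $k$-modules \[\operatorname{Ext}^{\star}_{\mathcal{B}_n(\delta)}(\mathbf{1},\mathbf{1})\cong H^\star(\Sigma_n,\mathbf{1}).\]
   Context: A Brauer $n$-diagram is a graph on vertices $1,\dots,n$ (left column, top to bottom) and $\bar1,\dots,\bar n$ (right column) in which each vertex lies on exactly one edge and each edge joins distinct vertices; diagrams are determined by which pairs are joined. Edges joining the two columns are propagating. The Brauer algebra $\mathcal{B}_n(\delta)$ is the free $k$-module on Brauer $n$-diagrams with product: identify the right column of $d_1$ with the left column of $d_2$ (middle column); let $\alpha$ be the number of closed loops lying in the middle column; let $d_3$ join two outer vertices iff they are joined by a path; $d_1d_2=\delta^\alpha d_3$. The augmentation $\tau$ sends diagrams with $n$ propagating edges to $1$ and all others to $0$; $\mathbf{1}$ is $k$ with the algebra acting via $\tau$. $H^\star(\Sigma_n,\mathbf{1})$ is group cohomology with trivial coefficients $k$. *)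

(* Defs.v *)
From HB Require Import structures.
From mathcomp Require Import all_boot all_order all_algebra all_fingroup.
Set Implicit Arguments. Unset Strict Implicit. Unset Printing Implicit Defensive.
Import GRing.Theory.
Local Open Scope ring_scope.

(* A vertex is (b, i) with b = false for the left column (vertex i+1)  *)
(* and b = true for the right column (vertex \bar{i+1}).  A diagram is  *)
(* a fixed-point-free involution of the vertex set: d x is the vertex  *)
(* joined to x.                                                        *)
Section Brauer.
Variable n : nat.

Definition bvert := (bool * 'I_n)%type.

Definition is_brauer (f : {ffun bvert -> bvert}) : bool :=
  [forall x, (f x != x) && (f (f x) == x)].

Definition brauer := {f : {ffun bvert -> bvert} | is_brauer f}.

Definition id_brauer_fun : {ffun bvert -> bvert} := [ffun x => (~~ x.1, x.2)].

Lemma id_brauer_proof : is_brauer id_brauer_fun.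
Proof.
apply/forallP => -[b i]; rewrite !ffunE /=.
by rewrite negbK eqxx andbT; case: b.
Qed.

Definition id_brauer : brauer := exist _ id_brauer_fun id_brauer_proof.

(* Concatenation graph: columns c0 (left of d1), c1 (middle column),   *)
(* c2 (right of d2).                                                    *)
Definition c0 : 'I_3 := @Ordinal 3 0 isT.
Definition c1 : 'I_3 := @Ordinal 3 1 isT.
Definition c2 : 'I_3 := @Ordinal 3 2 isT.

Definition mvert := ('I_3 * 'I_n)%type.

Definition emb1 (x : bvert) : mvert := (if x.1 then c1 else c0, x.2).
Definition emb2 (x : bvert) : mvert := (if x.1 then c2 else c1, x.2).

Definition cedge (d1 d2 : brauer) : rel mvert := fun u v =>
  [exists x, (emb1 x == u) && (emb1 (val d1 x) == v)]
  || [exists x, (emb2 x == u) && (emb2 (val d2 x) == v)].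

Definition outer (u : mvert) : bool := (u.1 : nat) != 1%N.
Definition embO (x : bvert) : mvert := (if x.1 then c2 else c0, x.2).
Definition projO (u : mvert) : bvert := ((u.1 : nat) == 2%N, u.2).

Definition comp_fun (d1 d2 : brauer) : {ffun bvert -> bvert} :=
  [ffun x => if [pick v | outer v && (v != embO x)
                           && connect (cedge d1 d2) (embO x) v]
             is Some v then projO v else x].

(* (comp_fun d1 d2 is always a Brauer diagram; the default is never used) *)
Definition comp (d1 d2 : brauer) : brauer := insubd id_brauer (comp_fun d1 d2).

(* number of closed loops lying in the middle column = number of       *)
(* connected components containing no outer vertex                      *)
Definition loops (d1 d2 : brauer) : nat :=
  n_comp (cedge d1 d2)
    [pred u | [forall v, connect (cedge d1 d2) u v ==> ~~ outer v]].

End Brauer.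

(* Bar-complex cochains computing Ext_A(1,1) for an algebra A that is  *)
(* k-free on a basis D, with basis product  mul a b = (c, d)  meaning   *)
(* a * b = c d, and augmentation aug : D -> k.  A p-cochain is a         *)
(* function on sequences of length p (values on other lengths are      *)
(* irrelevant): Hom_A(A (x) A^{(x)p} (x) 1, 1) = Hom_k(A^{(x)p}, k).     *)
Section Bar.
Variables (k : comPzRingType) (D : Type) (mul : D -> D -> k * D) (aug : D -> k).

Definition bar_d (g : seq D -> k) (s : seq D) : k :=
  match s with
  | [::] => 0
  | a :: s' =>
      aug a * g s'
      + \sum_(j < (size s).-1)
          (-1) ^+ j.+1 * (mul (nth a s j) (nth a s j.+1)).1
          * g (take j s ++ (mul (nth a s j) (nth a s j.+1)).2 :: drop j.+2 s)
      + (-1) ^+ size s * g (belast a s') * aug (last a s')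
  end.

Definition cocycle (p : nat) (g : seq D -> k) : Prop :=
  forall s, size s = p.+1 -> bar_d g s = 0.

Definition coboundary (p : nat) (g : seq D -> k) : Prop :=
  match p with
  | 0 => g [::] = 0
  | q.+1 => exists h : seq D -> k, forall s, size s = q.+1 -> g s = bar_d h s
  end.

End Bar.

(* An isomorphism of k-modules  Z^p_1/B^p_1 ~= Z^p_2/B^p_2  given by a   *)
(* map on representatives.                                              *)
Definition cohom_iso (k : comPzRingType) (D1 D2 : Type)
  (mul1 : D1 -> D1 -> k * D1) (aug1 : D1 -> k)
  (mul2 : D2 -> D2 -> k * D2) (aug2 : D2 -> k) (p : nat) : Prop :=
  exists F : (seq D1 -> k) -> (seq D2 -> k),
  [/\
      forall f, cocycle mul1 aug1 p f -> cocycle mul2 aug2 p (F f),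
      forall f g, cocycle mul1 aug1 p f -> cocycle mul1 aug1 p g ->
        coboundary mul1 aug1 p (fun s => f s - g s) ->
        coboundary mul2 aug2 p (fun s => F f s - F g s),
      forall (a : k) f g, cocycle mul1 aug1 p f -> cocycle mul1 aug1 p g ->
        coboundary mul2 aug2 p
          (fun s => F (fun t => a * f t + g t) s - (a * F f s + F g s)),
      forall f, cocycle mul1 aug1 p f -> coboundary mul2 aug2 p (F f) ->
        coboundary mul1 aug1 p f
    &
      forall h, cocycle mul2 aug2 p h ->
        exists2 f, cocycle mul1 aug1 p f &
          coboundary mul2 aug2 p (fun s => F f s - h s)].

Definition brauer_mul (k : comPzRingType) (n : nat) (delta : k)
  (d1 d2 : brauer n) : k * brauer n :=
  (delta ^+ loops d1 d2, comp d1 d2).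

Definition brauer_aug (k : comPzRingType) (n : nat) (d : brauer n) : k :=
  if [forall x, (val d x).1 != x.1] then 1 else 0.

Definition sym_mul (k : comPzRingType) (n : nat) (s t : 'S_n) : k * 'S_n :=
  (1, (s * t)%g).

Definition sym_aug (k : comPzRingType) (n : nat) (s : 'S_n) : k := 1.

Definition ext_brauer_iso_group_cohom (k : comPzRingType) (n : nat) (delta : k)
  (p : nat) : Prop :=
  cohom_iso (@brauer_mul k n delta) (@brauer_aug k n)
            (@sym_mul k n) (@sym_aug k n) p.

(* Main.v *)
(* Restricting bar cochains to the permutation diagrams is onto in cohomology, *)
(* because extension by zero is a section: the non-permutation diagrams span a *)
(* two-sided ideal I killed by the augmentation.  It is injective as soon as   *)
(* the cochains vanishing on all tuples of permutations form an acyclic        *)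
(* complex.  Filter that complex by the number of leading permutations; the    *)
(* graded pieces are copies of the bar complex of the right ideal I.  Now I is *)
(* the sum of the right ideals J_S spanned by the diagrams containing a given  *)
(* nonempty set S of arcs in the left column, J_S and J_T meet in J_(S u T),   *)
(* and J_S is zero or generated by a diagram e with e x = delta^l x on J_S, so *)
(* for delta invertible J_S is acyclic, and so is I by Mayer-Vietoris.         *)
(* Associativity of the Brauer product is checked on the matrices whose        *)
(* entries say which 2-colourings of the two columns are constant on the edges *)
(* of a diagram: these determine the diagram, and by counting the colourings   *)
(* of the middle column they multiply like diagrams with parameter 2.          *)
Require Import Defs.
From mathcomp Require Import all_boot all_order all_algebra all_fingroup.
From mathcomp Require Import zify ring.
Local Open Scope ring_scope.
Set Implicit Arguments. Unset Strict Implicit. Unset Printing Implicit Defensive.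
Import GRing.Theory.

(** * Bar cochains *)

(** The restriction map sketched above is a cochain map by [bar_d_map] and is split by [extend0].
    Its injectivity in cohomology is [relative_cocycle_coboundary], which rests on acyclicity of the
    complementary right ideal. For Brauer diagrams this acyclicity ([right_acyclic_notpropagating])
    combines Mayer-Vietoris ([right_acyclicU]) with contraction by a left unit up to an invertible
    scalar ([right_acyclic_unit]); the scalars are powers of [delta]. The facts on diagrams come
    from one count of colourings, [card_proper_pairs]. *)

Section BarComplex.
Variables (k : comPzRingType) (D : Type) (mul : D -> D -> k * D) (aug : D -> k).
Implicit Types (g h : seq D -> k) (s t : seq D) (a b : D).

Definition act a g s : k :=
  if s is b :: t then (mul a b).1 * g ((mul a b).2 :: t) else aug a * g [::].

(** The bar differential without its leading augmentation term, sign reversed. Omitting that term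
    keeps the first entry inside any right ideal. *)
Fixpoint rbar_d g s : k :=
  if s is a :: t then act a g t - rbar_d (fun u => g (a :: u)) t else 0.

Definition augd g s : k := if s is a :: t then aug a * g t else 0.

Lemma bar_dE g s : bar_d mul aug g s = augd g s - rbar_d g s.
Proof.
case: s => [|a s]; first by rewrite /= subr0.
rewrite /bar_d /augd -addrA; congr (_ + _).
(* The default of [nth] is freed from the head [a], which changes in the induction. *)
suff H x0 : \sum_(j < size s)
     (-1) ^+ j.+1 * (mul (nth x0 (a :: s) j) (nth x0 s j)).1 *
     g (take j (a :: s) ++ (mul (nth x0 (a :: s) j) (nth x0 s j)).2 :: drop j.+1 s) +
   (-1) ^+ (size s).+1 * g (belast a s) * aug (last a s) = - rbar_d g (a :: s).
  exact: H.
elim: s a g => [|b s IH] a g.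
  by rewrite big_ord0 /= subr0 add0r expr1 mulN1r mulNr mulrC.
rewrite big_ord_recl /= !drop0 expr1 mulN1r.
have /= := IH b (fun u => g (a :: u)).
set S := \sum_(_ < _) _; set S' := \sum_(_ < _) _.
have -> : S' = - S.
  rewrite -sumrN; apply: eq_bigr => j _.
  by rewrite /bump /= add1n exprS !mulN1r !mulNr.
move=> <-; rewrite exprS; ring.
Qed.

Lemma eq_rbar_d g h s :
  (forall t, (size t).+1 = size s -> g t = h t) -> rbar_d g s = rbar_d h s.
Proof.
elim: s g h => [|a s IH] g h E //=; congr (_ - _).
  by case: s E {IH} => [|b s] E /=; rewrite E.
by apply: IH => t ts; apply: E; rewrite /= ts.
Qed.

Lemma eq_bar_d g h s :
  (forall t, (size t).+1 = size s -> g t = h t) ->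
  bar_d mul aug g s = bar_d mul aug h s.
Proof.
move=> E; rewrite !bar_dE (eq_rbar_d E); congr (_ - _).
by case: s E => //= a s ->.
Qed.

Lemma rbar_d_lin (x : k) g h s :
  rbar_d (fun t => x * g t + h t) s = x * rbar_d g s + rbar_d h s.
Proof.
elim: s g h => [|a s IH] g h /=; first by rewrite mulr0 addr0.
by rewrite IH; case: s {IH} => [|b s] /=; ring.
Qed.

Lemma bar_d_lin (x : k) g h s :
  bar_d mul aug (fun t => x * g t + h t) s
  = x * bar_d mul aug g s + bar_d mul aug h s.
Proof. by rewrite !bar_dE rbar_d_lin; case: s => [|a s] /=; ring. Qed.

Lemma rbar_d0 s : rbar_d (fun=> 0) s = 0.
Proof. by elim: s => //= a [|b s] ->; rewrite /= mulr0 subr0. Qed.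

Lemma bar_d0 s : bar_d mul aug (fun=> 0) s = 0.
Proof. by rewrite bar_dE rbar_d0 subr0; case: s => //= a s; rewrite mulr0. Qed.

Lemma coboundaryP p g :
  coboundary mul aug p g
  <-> exists h, forall s, size s = p -> g s = bar_d mul aug h s.
Proof.
case: p => //=; split=> [g0|[h E]]; last by rewrite E.
by exists g => s /size0nil ->.
Qed.

Hypothesis augM : forall a b, aug a * aug b = (mul a b).1 * aug (mul a b).2.
Hypothesis mulDA : forall a b d, (mul (mul a b).2 d).2 = (mul a (mul b d).2).2.
Hypothesis mulcA : forall a b d,
  (mul a b).1 * (mul (mul a b).2 d).1 = (mul b d).1 * (mul a (mul b d).2).1.

Lemma act_comp a b g s :
  act b (act a g) s = (mul a b).1 * act (mul a b).2 g s.
Proof.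
case: s => [|d s] /=; first by rewrite !mulrA -augM; ring.
by rewrite mulDA !mulrA mulcA.
Qed.

(** Associativity, as [act_comp], makes multiplication into the first entry commute with the
    differential; this reduces [rbar_dK] to an induction on the tuple. *)
Lemma act_rbar_d a g s : act a (rbar_d g) s = rbar_d (act a g) s.
Proof.
case: s => [|b s] /=; first by rewrite mulr0.
have -> : rbar_d (fun u => (mul a b).1 * g ((mul a b).2 :: u)) s
        = (mul a b).1 * rbar_d (fun u => g ((mul a b).2 :: u)) s.
  rewrite -[RHS]addr0 -[0 in RHS](rbar_d0 s) -rbar_d_lin.
  by apply: eq_rbar_d => t _; rewrite addr0.
by rewrite act_comp mulrBr.
Qed.

Lemma rbar_dK g s : rbar_d (rbar_d g) s = 0.
Proof.
elim: s g => //= a s IH g; rewrite act_rbar_d.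
have -> : rbar_d (fun u => act a g u - rbar_d (fun v => g (a :: v)) u) s
        = rbar_d (act a g) s - rbar_d (rbar_d (fun v => g (a :: v))) s.
  rewrite addrC -mulN1r -rbar_d_lin.
  by apply: eq_rbar_d => t _; rewrite mulN1r addrC.
by rewrite IH subr0 subrr.
Qed.

Lemma bar_dK g s : bar_d mul aug (bar_d mul aug g) s = 0.
Proof.
rewrite (@eq_bar_d _ (fun t => -1 * rbar_d g t + augd g t)); last first.
  by move=> t _; rewrite bar_dE mulN1r addrC.
rewrite bar_d_lin !bar_dE rbar_dK; case: s => [|a s] /=; first by ring.
have -> : rbar_d (fun u => aug a * g u) s = aug a * rbar_d g s.
  rewrite -[RHS]addr0 -[0 in RHS](rbar_d0 s) -rbar_d_lin.
  by apply: eq_rbar_d => t _; rewrite addr0.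
have -> : act a (augd g) s = aug a * augd g s.
  by case: s => [|b s] //=; rewrite !mulrA augM.
ring.
Qed.

(* The right ideal spanned by X has bar cochains g (x :: s) with x in X.  As  *)
(* aug vanishes on X, the term h [::] does not contribute when s = [::].      *)
Definition right_acyclic (X : pred D) := forall m g,
  (forall x s, X x -> size s = m.+1 -> rbar_d g (x :: s) = 0) ->
  exists h, forall x s, X x -> size s = m -> g (x :: s) = rbar_d h (x :: s).

Definition right_ideal (X : pred D) :=
  (forall x, X x -> aug x = 0) /\ (forall x a, X x -> X (mul x a).2).

(** Products formed from the head stay in the ideal, and the term at the empty tuple carries the
    factor [aug x = 0]. *)
Lemma eq_rbar_d_ideal (X : pred D) g h x s :
  right_ideal X -> X x ->
  (forall y t, X y -> (size t).+1 = size s -> g (y :: t) = h (y :: t)) ->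
  rbar_d g (x :: s) = rbar_d h (x :: s).
Proof.
move=> [augX mulX] Xx E /=; congr (_ - _); last first.
  by apply: eq_rbar_d => t ts; exact: E.
case: s E => [|b s] E /=; first by rewrite augX // !mul0r.
by rewrite E //; exact: mulX.
Qed.

(** Mayer-Vietoris: primitives [g1] on [X] and [g2] on [Y] differ on the intersection by a cocycle,
    hence by some [rbar_d u]. Replacing [g2] by [g2 + rbar_d u] lets them glue. *)
Lemma right_acyclicU (X Y : pred D) :
  right_ideal X -> right_ideal Y -> right_acyclic X -> right_acyclic Y ->
  right_acyclic (predI X Y) -> right_acyclic (predU X Y).
Proof.
move=> iX iY aX aY aXY m g Zg.
have [g1 E1] := aX m g (fun x s Xx => Zg x s (introT orP (or_introl Xx))).
have [g2 E2] := aY m g (fun x s Yx => Zg x s (introT orP (or_intror Yx))).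
case: m Zg E1 E2 => [|m] Zg E1 E2.
  (* In lowest degree [g [:: x]] is already zero, being a multiple of [aug x]. *)
  exists (fun=> 0) => x s XYx /size0nil ->; rewrite rbar_d0.
  case/orP: XYx => Vx; first by rewrite E1 //= iX.1 // mul0r subr0.
  by rewrite E2 //= iY.1 // mul0r subr0.
have [u Eu] : exists u, forall x s, predI X Y x -> size s = m ->
    g1 (x :: s) - g2 (x :: s) = rbar_d u (x :: s).
  have [//|u Eu] := aXY m (fun t => -1 * g2 t + g1 t).
    by move=> x s /andP[Xx Yx] ss; rewrite rbar_d_lin -E1 // -E2 //; ring.
  by exists u => x s Vx ss; rewrite -Eu //; ring.
pose g' t := if t is x :: s then
  if X x then g1 t else 1 * rbar_d u t + g2 t else 0.
exists g' => x s XYx ss; case/orP: XYx => Vx.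
  rewrite E1 //; apply: (eq_rbar_d_ideal iX) => // y t Xy ts.
  by rewrite /g' Xy.
transitivity (rbar_d (fun t => 1 * rbar_d u t + g2 t) (x :: s)).
  by rewrite rbar_d_lin rbar_dK E2 // mulr0 add0r.
apply: (eq_rbar_d_ideal iY) => // y t Yy ts.
rewrite /g'; case: ifP => // Xy; rewrite -Eu ?inE /= ?Xy //; first by ring.
by rewrite ss in ts; case: ts.
Qed.

Lemma eq_right_acyclic (X Y : pred D) : X =1 Y -> right_acyclic X -> right_acyclic Y.
Proof.
move=> E aX m g Zg; have [|h Eh] := aX m g.
  by move=> x s; rewrite E; exact: Zg.
by exists h => x s; rewrite -E; exact: Eh.
Qed.

Lemma right_acyclic0 : right_acyclic pred0.
Proof. by move=> m g _; exists g. Qed.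

(** Contracting homotopy: prepend [e] and divide by [x], since the first term of
    [rbar_d g (e :: y :: s) = 0] is [x * g (y :: s)]. *)
Lemma right_acyclic_unit (X : pred D) e (x x' : k) :
  X e -> x' * x = 1 -> (forall y, X y -> mul e y = (x, y)) -> right_acyclic X.
Proof.
move=> Xe xK Ee m g Zg; exists (fun t => x' * g (e :: t) + 0) => y s Xy ss.
rewrite rbar_d_lin rbar_d0 addr0.
have /eqP := Zg e (y :: s) Xe (congr1 S ss).
by rewrite [rbar_d _ _]/= Ee //= subr_eq0 => /eqP <-; rewrite mulrA xK mul1r.
Qed.

(** Induction on the number of ideals: [J S] meets the union over [r] in the union over the lists
    [S ++ T], a family of the same length as [r]. *)
Lemma right_acyclic_has (I : Type) (J : seq I -> pred D) (r : seq (seq I)) :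
  (forall S T x, J (S ++ T) x = J S x && J T x) ->
  (forall S, ~~ nilp S -> right_ideal (J S) /\ right_acyclic (J S)) ->
  all (fun S => ~~ nilp S) r -> right_acyclic (fun x => has (J^~ x) r).
Proof.
move=> Jcat JS; have [l] := ubnP (size r); elim: l r => // l IH [|S r] /= lr.
  by move=> _; exact: right_acyclic0.
case/andP=> S0 r0; have [iS aS] := JS S S0.
have ir : right_ideal (fun x => has (J^~ x) r).
  split=> [x|x a].
    elim: r r0 {lr} => //= T r IHr /andP[T0 r0] /orP[|/(IHr r0)//].
    exact: (JS T T0).1.1.
  elim: r r0 {lr} => //= T r IHr /andP[T0 r0] /orP[|/(IHr r0)->].
    by move=> /((JS T T0).1.2 _ a) ->.
  exact: orbT.
apply: (@eq_right_acyclic (predU (J S) (fun x => has (J^~ x) r))) => //.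
apply: right_acyclicU => //; first by apply: IH.
apply: (@eq_right_acyclic (fun x => has (J^~ x) (map (cat S) r))).
  by move=> x /=; elim: r {lr r0 ir} => /= [|T r ->]; rewrite ?andbF // Jcat andb_orr.
apply: IH; first by rewrite size_map.
by rewrite all_map; apply: sub_all r0 => T; rewrite /= /nilp size_cat; case: (S) S0.
Qed.

End BarComplex.

(** * Dividing out an acyclic ideal spanned by basis elements *)

Section Quotient.
Variables (k : comPzRingType) (D : finType) (mul : D -> D -> k * D) (P : pred D).
Implicit Types (g h : seq D -> k) (a b : D).
Local Notation aug := (fun a => if P a then 1 else 0 : k).
Local Notation bar := (bar_d mul aug).
Local Notation rbar := (rbar_d mul aug).

Hypothesis PM : forall a b, P (mul a b).2 = P a && P b.

Lemma bar_d_all g s :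
  (forall t, all P t -> g t = 0) -> all P s -> bar g s = 0.
Proof.
move=> g0 Ps; rewrite bar_dE.
have -> : augd aug g s = 0.
  by case: s Ps => //= a s /andP[_ /g0->]; rewrite mulr0.
suff -> : rbar g s = 0 by rewrite subr0.
elim: s g g0 Ps => //= a s IH g g0 /andP[Pa Ps].
rewrite IH // => [|t Pt]; last by rewrite g0 //= Pa.
case: s Ps {IH} => [|b s] /=; first by rewrite g0 // mulr0 subr0.
by case/andP=> Pb Ps; rewrite g0 ?mulr0 ?subr0 //= PM Pa Pb.
Qed.

Lemma bar_d_notall g s :
  (forall t, ~~ all P t -> g t = 0) -> ~~ all P s -> bar g s = 0.
Proof.
move=> g0 Ps; rewrite bar_dE.
have -> : augd aug g s = 0.
  by case: s Ps => //= a s; case: (P a) => /= Ps; rewrite ?mul0r // g0 // mulr0.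
suff -> : rbar g s = 0 by rewrite subr0.
elim: s g g0 Ps => //= a s IH g g0 Ps.
have -> : act mul aug a g s = 0.
  case: s Ps {IH} => [|b s] /=; first by rewrite andbT => /negPf->; rewrite mul0r.
  by move=> Ps; rewrite g0 ?mulr0 //= PM -andbA.
have [Pa|nPa] := boolP (P a); last first.
  rewrite (@eq_rbar_d _ _ _ _ _ (fun=> 0)) ?rbar_d0 ?subr0 // => t _.
  by rewrite g0 //= negb_and nPa.
rewrite IH ?subr0 //; first by move=> t Pt; rewrite g0 //= negb_and Pt orbT.
by rewrite Pa in Ps.
Qed.

(** Dropping the first entry of [w], or merging two entries no later than [x], shortens the leading
    run in [P], where [g] vanishes. What survives acts on [x :: s], so the graded piece is a
    right-ideal complex up to sign. *)
Lemma bar_d_prefix w x s g :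
  all P w -> ~~ P x ->
  (forall t, size t = (size w + size s)%N -> (find (predC P) t < size w)%N -> g t = 0) ->
  bar g (w ++ x :: s) = (-1) ^+ (size w).+1 * rbar (fun t => g (w ++ t)) (x :: s).
Proof.
move=> Pw nPx g0; rewrite bar_dE.
have -> : augd aug g (w ++ x :: s) = 0.
  case: w Pw g0 => [|a w] /=; first by rewrite (negPf nPx) mul0r.
  case/andP=> Pa Pw -> //; rewrite ?mulr0 ?size_cat /= ?addnS //.
  by rewrite find_cat has_predC Pw /= nPx addn0.
rewrite sub0r exprS -mulrA mulN1r; congr (- _).
elim: w g Pw g0 => [|a w IH] g /=; first by rewrite mul1r.
case/andP=> Pa Pw g0; rewrite exprS -mulrA mulN1r.
rewrite -(IH (fun t => g (a :: t))) //; last first.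
  by move=> t ts ft; rewrite g0 /= ?ts // Pa.
have -> : act mul aug a g (w ++ x :: s) = 0; last by rewrite sub0r.
case: w Pw g0 {IH} => [_|b w /= /andP[Pb Pw]] g0 /=.
  by rewrite g0 ?mulr0 //= PM negb_and nPx orbT.
rewrite g0 ?mulr0 /= ?size_cat ?addnS // PM Pa Pb /=.
by rewrite find_cat has_predC Pw /= nPx addn0.
Qed.

Lemma split_notall s : ~~ all P s ->
  exists w x t, [/\ s = w ++ x :: t, all P w, ~~ P x & find (predC P) s = size w].
Proof.
elim: s => //= a s IH; have [Pa|nPa _] := boolP (P a); last by exists [::], a, s.
by case/IH=> w [x [t [-> Pw nPx ->]]]; exists (a :: w), x, t; rewrite /= Pa.
Qed.

Hypothesis acyclicNP : right_acyclic mul aug (predC P).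

Lemma ideal_predC : right_ideal mul aug (predC P).
Proof.
by split=> [x /negPf->|x a] //=; rewrite PM negb_and => ->.
Qed.

(** One filtration step: for each [w] of [j] entries in [P], [g (w ++ -)] is a cocycle on the ideal
    and has a primitive. These assemble into an [h] supported on tuples whose first entry outside
    [P] has index [j]. *)
Lemma coboundary_step p j g :
  (forall s, size s = p.+1 -> bar g s = 0) ->
  (forall s, all P s -> g s = 0) ->
  (forall s, size s = p -> (find (predC P) s < j)%N -> g s = 0) ->
  exists h, (forall s, all P s -> bar h s = 0) /\
    forall s, size s = p -> (find (predC P) s < j.+1)%N -> g s = bar h s.
Proof.
move=> Zg g0 gj; have [pj|jp] := leqP p j.
  exists (fun=> 0); split=> [s _|s ps _]; rewrite bar_d0 //.
  have [/g0//|] := boolP (all P s).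
  by rewrite -has_predC has_find ps => /leq_trans/(_ pj); exact: gj.
have [m pE] : exists m, p = (j + m).+1.
  by exists (p - j.+1)%N; rewrite -addSn subnKC.
have aw (w : j.-tuple D) : exists u, forall x s, all P w -> ~~ P x -> size s = m ->
    g (w ++ x :: s) = rbar u (x :: s).
  have [Pw|] := boolP (all P w); last by exists (fun=> 0).
  have [|u Eu] := acyclicNP (m := m) (g := fun t => g (w ++ t)).
    move=> x s nPx ss; have := Zg (w ++ x :: s).
    rewrite bar_d_prefix //; last first.
      by move=> t ts ft; apply: gj; rewrite ?ts ?size_tuple ?ss ?addnS // -(size_tuple w).
    rewrite size_cat size_tuple /= ss pE !addnS => /(_ erefl).
    move=> /(congr1 (fun z => (-1) ^+ j.+1 * z)).
    by rewrite mulr0 mulrA -expr2 sqrr_sign mul1r.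
  by exists u => x s _; exact: Eu.
(* Finiteness of [D] allows choosing primitives for all [w] at once. *)
have {aw} [u Eu] := fin_all_exists aw.
pose v (w : seq D) := if insub w is Some w' then u w' else fun=> 0.
have Ev w x s : size w = j -> all P w -> ~~ P x -> size s = m ->
    g (w ++ x :: s) = rbar (v w) (x :: s).
  move=> /eqP wj; rewrite /v insubT; exact: (Eu (Tuple wj)).
(* On tuples inside [P], [find] returns the length, so they are excluded explicitly. The sign
   cancels that of [bar_d_prefix]. *)
pose h t := if (find (predC P) t == j) && ~~ all P t
  then (-1) ^+ j.+1 * v (take j t) (drop j t) else 0.
have h0 t : all P t -> h t = 0 by rewrite /h => ->; rewrite andbF.
have hlead t : find (predC P) t != j -> h t = 0 by rewrite /h => /negPf->.
exists h; split=> [s|s sp]; first exact: bar_d_all.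
have [Ps _|/split_notall[w [x [t [sE Pw nPx ->]]]]] := boolP (all P s).
  by rewrite g0 // bar_d_all.
rewrite ltnS leq_eqVlt => /predU1P[wj|wj]; rewrite sE bar_d_prefix //.
- have tm : size t = m.
    by move: sp; rewrite sE size_cat /= wj pE addnS => -[] /addnI.
  rewrite Ev // wj.
  rewrite (@eq_rbar_d_ideal _ _ _ _ _ (fun y => h (w ++ y)) (fun y => (-1) ^+ j.+1 * v w y + 0) _ _ ideal_predC) //.
    by rewrite rbar_d_lin rbar_d0 addr0 mulrA -expr2 sqrr_sign mul1r.
  move=> y z /= nPy zs; rewrite /h find_cat has_predC Pw /= nPy addn0 wj eqxx.
  rewrite all_cat /= (negPf nPy) andbF /= addr0.
  by rewrite take_size_cat // drop_size_cat.
- by move=> z _; rewrite wj => zj; rewrite hlead // ltn_eqF.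
- rewrite -sE gj //; last by rewrite sE find_cat has_predC Pw /= nPx addn0.
  rewrite (@eq_rbar_d_ideal _ _ _ _ _ (fun y => h (w ++ y)) (fun=> 0) _ _ ideal_predC) ?rbar_d0 ?mulr0 //.
  move=> y z /= nPy _; rewrite hlead //.
  by rewrite find_cat has_predC Pw /= nPy addn0 ltn_eqF.
- by move=> z _ /ltn_trans/(_ wj) zj; rewrite hlead // ltn_eqF.
Qed.

Hypothesis mulDA : forall a b d, (mul (mul a b).2 d).2 = (mul a (mul b d).2).2.
Hypothesis mulcA : forall a b d,
  (mul a b).1 * (mul (mul a b).2 d).1 = (mul b d).1 * (mul a (mul b d).2).1.
Hypothesis Pmul1 : forall a b, P a -> P b -> (mul a b).1 = 1.

Lemma quotient_augM a b : aug a * aug b = (mul a b).1 * aug (mul a b).2.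
Proof.
rewrite /= PM; case Pa: (P a); case Pb: (P b); rewrite /= ?mulr0 ?mul0r //.
by rewrite Pmul1.
Qed.

Lemma quotient_bar_dK g s : bar (bar g) s = 0.
Proof. by apply: bar_dK; [exact: quotient_augM | exact: mulDA | exact: mulcA]. Qed.

(** After [p] filtration steps every tuple of length [p] with an entry outside [P] is covered. *)
Lemma relative_cocycle_coboundary p g :
  (forall s, size s = p.+1 -> bar g s = 0) ->
  (forall s, all P s -> g s = 0) ->
  exists h, forall s, size s = p -> g s = bar h s.
Proof.
move=> Zg g0.
suff [h [h0 Eh]] : exists h, (forall s, all P s -> bar h s = 0) /\
    forall s, size s = p -> (find (predC P) s < p)%N -> g s = bar h s.
  exists h => s sp; have [Ps|] := boolP (all P s); first by rewrite g0 ?h0.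
  by rewrite -has_predC has_find sp; exact: Eh.
elim: {2}p => [|j [h [h0 Eh]]]; first by exists (fun=> 0); split=> // s _; exact: bar_d0.
have [||s sp sj|h' [h'0 Eh']] := @coboundary_step p j (fun s => -1 * bar h s + g s).
- by move=> s sp; rewrite bar_d_lin quotient_bar_dK Zg // mulr0 addr0.
- by move=> s Ps; rewrite h0 // g0 // mulr0 addr0.
- by rewrite Eh // mulN1r addNr.
exists (fun s => 1 * h s + h' s); split=> [s Ps|s sp sj].
  by rewrite bar_d_lin h0 // h'0 // mulr0 addr0.
by rewrite bar_d_lin -Eh' //; ring.
Qed.

Variables (E : Type) (mulE : E -> E -> k * E) (i : E -> D) (r : D -> E).
Hypotheses (iK : cancel i r) (rK : forall a, P a -> i (r a) = a).
Hypothesis Pi : forall x, P (i x).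
Hypothesis mulEE : forall x y, mulE x y = (1, r (mul (i x) (i y)).2).
Local Notation augE := (fun=> 1 : k).

Lemma bar_d_map g (s : seq E) :
  bar_d mulE augE (fun t => g (map i t)) s = bar g (map i s).
Proof.
rewrite !bar_dE; congr (_ - _); first by case: s => //= x s; rewrite Pi.
elim: s g => //= x s IH g; rewrite (IH (fun t => g (i x :: t))); congr (_ - _).
case: s {IH} => [|y s] /=; rewrite ?Pi // mulEE /= Pmul1 ?Pi //.
by rewrite rK // PM !Pi.
Qed.

Definition extend0 (f : seq E -> k) s := if all P s then f (map r s) else 0.

Lemma extend0_map f s : extend0 f (map i s) = f s.
Proof.
rewrite /extend0 all_map (@eq_all _ _ predT) ?all_predT; last by move=> x /=; rewrite Pi.
by rewrite mapK.
Qed.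

Lemma bar_d_extend0 f s : bar (extend0 f) s = extend0 (bar_d mulE augE f) s.
Proof.
rewrite [RHS]/extend0; case: ifPn => Ps; last first.
  by rewrite bar_d_notall // /extend0 => t /negPf->.
have sE : s = map i (map r s).
  by rewrite -map_comp map_id_in // => x /(allP Ps); exact: rK.
rewrite {1}sE -bar_d_map; apply: eq_bar_d => t _; exact: extend0_map.
Qed.

(** Restriction along [i] is onto by [extend0]. If the restriction of [f] is the coboundary of [h],
    subtracting the coboundary of [extend0 h] from [f] leaves a cocycle vanishing on [P]-tuples. *)
Lemma quotient_cohom_iso p : cohom_iso mul aug mulE augE p.
Proof.
exists (fun f t => f (map i t)); split.
- by move=> f Zf s ss; rewrite bar_d_map Zf ?size_map.
- move=> f g _ _ /coboundaryP[h Eh]; apply/coboundaryP.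
  by exists (fun t => h (map i t)) => s ss; rewrite bar_d_map Eh ?size_map.
- move=> a f g _ _; apply/coboundaryP; exists (fun=> 0) => s _.
  by rewrite bar_d0 subrr.
- move=> f Zf /coboundaryP[h Eh]; apply/coboundaryP.
  (* [Eh] holds in length [p], while the relative lemma asks for vanishing on [P]-tuples of every
     length; hence the cut-off. *)
  pose g s := if size s == p then -1 * bar (extend0 h) s + f s else 0.
  have gE s : size s = p -> g s = -1 * bar (extend0 h) s + f s.
    by move=> sp; rewrite /g sp eqxx.
  have [s sp|s Ps|u Eu] := @relative_cocycle_coboundary p g.
  + rewrite (@eq_bar_d _ _ _ _ _ (fun s => -1 * bar (extend0 h) s + f s)); last first.
      by move=> t; rewrite sp => -[/gE].
    by rewrite bar_d_lin bar_dK ?Zf ?mulr0 ?addr0 //; exact: quotient_augM.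
  + rewrite /g; case: eqP => // sp; rewrite bar_d_extend0 /extend0 Ps.
    rewrite -Eh ?size_map // -map_comp map_id_in ?mulN1r ?addNr // => x /(allP Ps).
    exact: rK.
  exists (fun s => 1 * u s + extend0 h s) => s sp.
  by rewrite bar_d_lin -Eu // gE //; ring.
- move=> h Zh; exists (extend0 h) => [s ss|].
    by rewrite bar_d_extend0 /extend0; case: ifP => // _; rewrite Zh ?size_map.
  apply/coboundaryP; exists (fun=> 0) => s _.
  by rewrite extend0_map bar_d0 subrr.
Qed.

End Quotient.

(** * Composition of Brauer diagrams *)

Section TwoInvolutions.
Variables (T : finType) (s t : T -> T).
Hypotheses (sK : involutive s) (tK : involutive t).
Let e : rel T := fun u v => (s u == v) || (t u == v).

(* With r = s o t, the component of u is {r^i u}, on which t and s act as the *)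
(* reflections i |-> -i and i |-> 1 - i modulo the order of u under r.        *)
Lemma involutions_partner u :
  t u = u -> (forall v, ~ (s v = v /\ t v = v)) ->
  exists v, [/\ v != u, s v = v \/ t v = v, connect e u v
    & forall w, s w = w \/ t w = w -> connect e u w -> w = u \/ w = v].
Proof.
move=> tu nst; pose r x := s (t x); pose X i := iter i r u.
have r_inj : injective r by apply: inj_comp; apply: inv_inj.
have rtr x : r (t (r x)) = t x by rewrite /r tK sK.
pose m := fingraph.order r u.
have m_gt0 : (0 < m)%N by rewrite /m -orderSpred.
have X_inj i j : (i < m)%N -> (j < m)%N -> X i = X j -> i = j.
  by move=> im jm /(congr1 (findex r u)); rewrite !findex_iter.
have Xm : X m = u by exact: iter_order.
have tX i : (i <= m)%N -> t (X i) = X (m - i)%N.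
  move=> im; have H : iter i r (t (X i)) = u.
    rewrite /X; elim: i {im} => //= i IH.
    by rewrite -[RHS]IH -iterS iterSr rtr.
  have : injective (iter i r) by elim: (i) => //= j IH; apply: inj_comp.
  by apply; rewrite H /X -iterD subnKC.
have sX i : (0 < i <= m)%N -> s (X i) = X (m - i).+1.
  by case/andP=> i0 im; rewrite -{1}(subKn im) -tX ?leq_subr.
have XP v : connect e u v -> exists2 i, (i < m)%N & v = X i.
  move=> uv; suff : fconnect r u v.
    by move=> ruv; exists (findex r u v); rewrite ?findex_max ?/X ?iter_findex.
  have cl : closed e (fconnect r u).
    have st y : fconnect r u y -> fconnect r u (t y).
      move=> uy; rewrite -(iter_findex uy) tX ?fconnect_iter //.
      by rewrite ltnW // findex_max.
    have ss y : fconnect r u y -> fconnect r u (s y).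
      move=> uy; have := st _ uy => /connect_trans/(_ (fconnect1 _ _)).
      by rewrite /r tK.
    apply: intro_closed.
      apply: sym_connect_sym => x y; rewrite /e.
      by congr (_ || _); apply/eqP/eqP => <-; rewrite ?sK ?tK.
    move=> x y /orP[] /eqP<-; [exact: ss|exact: st].
  by have := closed_connect cl uv; rewrite !inE connect0 => <-.
have rX i : connect e u (X i).
  elim: i => //= i IH; apply: connect_trans IH _.
  apply: (@connect_trans _ _ (t (X i))); apply: connect1.
    by rewrite /e eqxx orbT.
  by rewrite /e eqxx.
have m1 : m != 1%N.
  apply/eqP=> m1; apply: (nst u); split=> //.
  by move: Xm; rewrite m1 /X /= /r tu.
(* For odd [m] the second fixed point solves [2i = 1] modulo [m] and is fixed by [s]; for even [m]
   it is [m / 2], fixed by [t]. *)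
have [m2|m2] := boolP (odd m).
- exists (X (uphalf m)); split.
  + apply/eqP => /(X_inj (uphalf m) 0); lia.
  + left; rewrite sX; last by lia.
    congr X; lia.
  + exact: rX.
  move=> w fw /XP[i im wE]; subst w; case: i im fw => [|i] im [fw|fw]; try by left.
    right; congr X; rewrite sX in fw; last by lia.
    have [im0|i0] := eqVneq i 0%N.
      subst i; move: fw; rewrite subn1 prednK // Xm => /(X_inj 0); lia.
    move/X_inj: fw; lia.
  move: fw; rewrite tX; last by lia.
  move/X_inj; lia.
- exists (X m./2); split.
  + apply/eqP => /(X_inj m./2 0); lia.
  + right; rewrite tX; last by lia.
    congr X; lia.
  + exact: rX.
  move=> w fw /XP[i im wE]; subst w; case: i im fw => [|i] im [fw|fw]; try by left.
    rewrite sX in fw; last by lia.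
    have [im0|i0] := eqVneq i 0%N.
      subst i; move: fw; rewrite subn1 prednK // Xm => /(X_inj 0); lia.
    move/X_inj: fw; lia.
  right; congr X; move: fw; rewrite tX; last by lia.
  move/X_inj; lia.
Qed.
End TwoInvolutions.

Section Composition.
Variable n : nat.
Implicit Types (d a b : brauer n) (x y : bvert n) (u v : mvert n).

Lemma brauerN d x : val d x != x.
Proof. by have /forallP/(_ x)/andP[] := valP d. Qed.

Lemma brauerK d : involutive (val d).
Proof. by move=> x; have /forallP/(_ x)/andP[_ /eqP] := valP d. Qed.

Lemma ord3P (c : 'I_3) : [\/ c = c0, c = c1 | c = c2].
Proof.
by case: c => -[|[|[|//]]] lt_c; [constructor 1|constructor 2|constructor 3];
  apply: val_inj.
Qed.

Lemma outer_embO x : outer (embO x).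
Proof. by case: x => -[]. Qed.

Lemma embOK : cancel (@embO n) (@projO n).
Proof. by case=> -[]. Qed.

Lemma projOK u : outer u -> embO (projO u) = u.
Proof. by case: u => c i; case: (ord3P c) => ->. Qed.

Section Pair.
Variables d1 d2 : brauer n.
Local Notation e := (cedge d1 d2).

(** [sig] and [tau] extend [d1] and [d2] by the identity on the column they do not touch. Outer
    vertices become the points fixed by one of them, and none is fixed by both, as
    [involutions_partner] requires. *)
Let sig u : mvert n := if u.1 == c2 then u else emb1 (val d1 (u.1 == c1, u.2)).
Let tau u : mvert n := if u.1 == c0 then u else emb2 (val d2 (u.1 == c2, u.2)).

Let sigE x : sig (emb1 x) = emb1 (val d1 x).
Proof. by case: x => -[] i. Qed.

Let tauE x : tau (emb2 x) = emb2 (val d2 x).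
Proof. by case: x => -[] i. Qed.

Let sig2 i : sig (c2, i) = (c2, i). Proof. by []. Qed.
Let tau0 i : tau (c0, i) = (c0, i). Proof. by []. Qed.

Let mvert1P u : (exists x, u = emb1 x) \/ (exists i, u = (c2, i)).
Proof.
case: u => c i; case: (ord3P c) => ->; last by right; exists i.
  by left; exists (false, i).
by left; exists (true, i).
Qed.

Let mvert2P u : (exists x, u = emb2 x) \/ (exists i, u = (c0, i)).
Proof.
case: u => c i; case: (ord3P c) => ->; first by right; exists i.
  by left; exists (false, i).
by left; exists (true, i).
Qed.

Let sigK : involutive sig.
Proof.
by move=> u; case: (mvert1P u) => [[x ->]|[i ->]]; rewrite ?sigE ?brauerK ?sig2.
Qed.

Let tauK : involutive tau.
Proof.
by move=> u; case: (mvert2P u) => [[x ->]|[i ->]]; rewrite ?tauE ?brauerK ?tau0.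
Qed.

Lemma emb1_inj : injective (@emb1 n).
Proof. by move=> [[] i] [[] j] //= [->]. Qed.

Lemma emb2_inj : injective (@emb2 n).
Proof. by move=> [[] i] [[] j] //= [->]. Qed.

Let sig_fix u : sig u = u <-> u.1 = c2.
Proof.
case: (mvert1P u) => [[x ->]|[i ->]] //; rewrite sigE; split=> [/emb1_inj E|].
  by have := brauerN d1 x; rewrite E eqxx.
by case: x => -[].
Qed.

Let tau_fix u : tau u = u <-> u.1 = c0.
Proof.
case: (mvert2P u) => [[x ->]|[i ->]] //; rewrite tauE; split=> [/emb2_inj E|].
  by have := brauerN d2 x; rewrite E eqxx.
by case: x => -[].
Qed.

Let outer_fix u : outer u <-> (sig u = u \/ tau u = u).
Proof.
rewrite sig_fix tau_fix; case: u => c i; case: (ord3P c) => -> /=; split=> //; auto.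
by case.
Qed.

Lemma cedge_sym : symmetric e.
Proof.
suff H u v : e u v -> e v u by move=> u v; apply/idP/idP; exact: H.
case/orP=> /existsP[x /andP[/eqP<- /eqP<-]]; apply/orP; [left|right];
  apply/existsP; [exists (val d1 x)|exists (val d2 x)]; by rewrite brauerK !eqxx.
Qed.

Let connect_sigtau u v :
  connect e u v = connect (fun u v => (sig u == v) || (tau u == v)) u v.
Proof.
apply/idP/idP; apply: connect_sub => {}u {}v.
  case/orP=> /existsP[x /andP[/eqP<- /eqP<-]]; apply: connect1.
    by rewrite sigE eqxx.
  by rewrite tauE eqxx orbT.
case/orP=> /eqP<-.
  case: (mvert1P u) => [[x ->]|[i ->]]; last by rewrite sig2 connect0.
  apply/connect1/orP; left; apply/existsP; exists x.
  by rewrite sigE !eqxx.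
case: (mvert2P u) => [[x ->]|[i ->]]; last by rewrite tau0 connect0.
apply/connect1/orP; right; apply/existsP; exists x.
by rewrite tauE !eqxx.
Qed.

Lemma outer_partner x : exists y, [/\ y != x, connect e (embO x) (embO y)
  & forall z, connect e (embO x) (embO z) -> z = x \/ z = y].
Proof.
have nfix v : ~ (sig v = v /\ tau v = v).
  by case=> /sig_fix v2 /tau_fix; rewrite v2.
have [v [vx ov xv H]] : exists v, [/\ v != embO x, outer v, connect e (embO x) v
  & forall w, outer w -> connect e (embO x) w -> w = embO x \/ w = v].
  have [E|E] := (outer_fix (embO x)).1 (outer_embO x); last first.
    have [v [vx /outer_fix ov xv H]] := involutions_partner sigK tauK E nfix.
    exists v; rewrite connect_sigtau; split=> // w /outer_fix ow.
    by rewrite connect_sigtau; exact: H.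
  have [|v [vx fv xv H]] := involutions_partner tauK sigK E.
    by move=> v [tv sv]; exact: (nfix v).
  have eE u w : connect e u w = connect (fun u v => (tau u == v) || (sig u == v)) u w.
    by rewrite connect_sigtau; apply: eq_connect => {}u {}w; rewrite orbC.
  exists v; rewrite eE; split=> //; first by apply/outer_fix; case: fv; auto.
  by move=> w /outer_fix ow; rewrite eE; apply: H; case: ow; auto.
exists (projO v); rewrite projOK //; split=> //.
  by apply: contraNneq vx => <-; rewrite projOK.
move=> z /(H _ (outer_embO z))[/(can_inj embOK)|<-]; first by left.
by right; rewrite embOK.
Qed.

Let comp_funP x : comp_fun d1 d2 x != x /\
  forall y, connect e (embO x) (embO y) = (y == x) || (y == comp_fun d1 d2 x).
Proof.
have [y [yx xy H]] := outer_partner x.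
have -> : comp_fun d1 d2 x = y.
  rewrite ffunE; case: pickP => [v /andP[/andP[ov vx] xv]|/(_ (embO y))].
    case: (H (projO v)); rewrite ?projOK // => E.
    by rewrite -E projOK // eqxx in vx.
  by rewrite outer_embO xy (inj_eq (can_inj embOK)) yx.
split=> // z; apply/idP/orP => [/H[->|->]|[/eqP->|/eqP->]] //; auto.
Qed.

(** Partners are unique and connectivity is symmetric, so [comp_fun] is an involution and [insubd]
    returns it. *)
Lemma comp_connect x y :
  connect e (embO x) (embO y) = (y == x) || (y == val (Defs.comp d1 d2) x).
Proof.
have [_ ->] := comp_funP x; rewrite /Defs.comp insubdK //.
apply/forallP => z; have [zN zE] := comp_funP z; rewrite zN /=.
have := (comp_funP (comp_fun d1 d2 z)).2 z.
rewrite (sym_connect_sym cedge_sym) zE eqxx orbT => /esym/orP[/eqP zz|/eqP<-] //.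
by rewrite -zz eqxx in zN.
Qed.

End Pair.

(** * Two-colourings of diagrams and associativity of the product *)

Implicit Types A B G : {set 'I_n}.

Definition side_colour A B x := x.2 \in (if x.1 then B else A).

(** Proper means constant along edges here. These are the 0/1 matrix entries of [d] on the [n]-th
    tensor power of a rank two module, the Brauer representation with parameter 2. *)
Definition proper_colouring d A B :=
  [forall x, side_colour A B (val d x) == side_colour A B x].

Lemma proper_colouringP d A B :
  reflect (forall x, side_colour A B (val d x) = side_colour A B x)
          (proper_colouring d A B).
Proof. exact: eqfunP. Qed.

Definition column_colour A G B u :=
  u.2 \in (if u.1 == c0 then A else if u.1 == c1 then G else B).

Lemma column_colour1 A G B x : column_colour A G B (emb1 x) = side_colour A G x.
Proof. by case: x => -[]. Qed.

Lemma column_colour2 A G B x : column_colour A G B (emb2 x) = side_colour G B x.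
Proof. by case: x => -[]. Qed.

Lemma column_colourO A G B x : column_colour A G B (embO x) = side_colour A B x.
Proof. by case: x => -[]. Qed.

Section Count.
Variables d1 d2 : brauer n.
Local Notation e := (cedge d1 d2).

Lemma proper_pairP A G B :
  reflect (forall u v, connect e u v -> column_colour A G B u = column_colour A G B v)
          (proper_colouring d1 A G && proper_colouring d2 G B).
Proof.
apply: (iffP andP) => [[/proper_colouringP W1 /proper_colouringP W2] u v|H].
  case/connectP=> p; elim: p u => [|w p IH] u /=; first by move=> _ ->.
  case/andP=> uw wp vE; rewrite -(IH w) //.
  case/orP: uw => /existsP[x /andP[/eqP<- /eqP<-]].
    by rewrite !column_colour1 W1.
  by rewrite !column_colour2 W2.
split; apply/proper_colouringP => x.
  rewrite -!(column_colour1 A G B); apply/esym/H/connect1/orP; left.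
  by apply/existsP; exists x; rewrite !eqxx.
rewrite -!(column_colour2 A G B); apply/esym/H/connect1/orP; right.
by apply/existsP; exists x; rewrite !eqxx.
Qed.

Lemma column_colour_outer A G G' B u : outer u ->
  column_colour A G B u = column_colour A G' B u.
Proof. by case: u => c i; case: (ord3P c) => ->. Qed.

Let loop_roots := [predI roots e & [pred u | [forall v, connect e u v ==> ~~ outer v]]].

(** Components meeting the outer columns have their colour forced by [A] and [B]; each closed loop
    is coloured freely in two ways. *)
Lemma card_proper_pairs A B :
  (#|[set G | proper_colouring d1 A G && proper_colouring d2 G B]|
   = 2 ^ loops d1 d2 * proper_colouring (Defs.comp d1 d2) A B)%N.
Proof.
have eC : connect_sym e by exact/sym_connect_sym/cedge_sym.
have [WAB|nWAB] := boolP (proper_colouring _ A B); last first.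
  rewrite muln0; apply/eqP; rewrite cards_eq0; apply/eqP/setP => G; rewrite !inE.
  apply: contraNF nWAB => /proper_pairP H; apply/proper_colouringP => x.
  rewrite -!(column_colourO A G B); apply/esym/H.
  by rewrite comp_connect eqxx orbT.
(* A component with an outer vertex takes its colour; a closed loop is coloured by whether its root
   lies in [L]. The filler [set0] sits in the middle column, which an outer [v] does not consult. *)
pose colour (L : {set mvert n}) u :=
  if [pick v | connect e u v && outer v] is Some v then column_colour A set0 B v
  else fingraph.root e u \in L.
have colour_connect L u v : connect e u v -> colour L u = colour L v.
  move=> uv; rewrite /colour (eq_pick (Q := [pred w | connect e v w && outer w])).
    by rewrite (fingraph.rootP eC uv).
  by move=> w /=; rewrite (same_connect eC uv).
have colour_outer L u : outer u -> colour L u = column_colour A set0 B u.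
  move=> ou; rewrite /colour; case: pickP => [v /andP[uv ov]|/(_ u)]; last first.
    by rewrite connect0 ou.
  move: uv; rewrite -(projOK ou) -(projOK ov) comp_connect !column_colourO.
  by case/orP=> /eqP-> //; move/proper_colouringP: WAB => ->.
have loop_root u : u \in loop_roots ->
    (forall v, connect e u v -> outer v = false) /\ fingraph.root e u = u.
  rewrite !inE => /andP[/eqP ru /forallP H]; split=> // v uv.
  by have /implyP/(_ uv)/negbTE := H v.
pose Phi L := [set i | colour L (c1, i)].
have PhiE L u : column_colour A (Phi L) B u = colour L u.
  have [ou|] := boolP (outer u); last first.
    by case: u => c i; case: (ord3P c) => -> // _; rewrite /column_colour inE.
  by rewrite colour_outer // (column_colour_outer _ _ set0).
suff -> : [set G | proper_colouring d1 A G && proper_colouring d2 G B]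
        = Phi @: powerset [set u in loop_roots].
  rewrite card_in_imset ?card_powerset ?cardsE ?muln1 // => L L'.
  rewrite !powersetE => /subsetP sL /subsetP sL' E; apply/setP => u.
  have [lu|lu] := boolP (u \in loop_roots); last first.
    by apply/idP/idP => [/sL|/sL']; rewrite inE (negPf lu).
  have [ou ru] := loop_root u lu; have := PhiE L u; rewrite E PhiE /colour.
  case: pickP => [v /andP[/ou->]//|_]; by rewrite ru.
apply/setP => G; rewrite inE; apply/idP/imsetP => [/proper_pairP H|[L _ ->]].
  exists [set u in loop_roots | u.2 \in G].
    by rewrite powersetE; apply/subsetP => u; rewrite !inE => /andP[].
  apply/setP => i; rewrite inE /colour.
  have -> : (i \in G) = column_colour A G B (c1, i) by [].
  case: pickP => [v /andP[/H-> ov]|nv]; first exact: column_colour_outer.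
  rewrite inE (H _ _ (connect_root e _)); set u := fingraph.root _ _.
  have nou v : connect e u v -> outer v = false.
    move=> uv; apply/negbTE/negP => ov; have := nv v.
    by rewrite ov (connect_trans (connect_root e _) uv).
  have -> : u \in loop_roots.
    rewrite !inE roots_root //=; apply/forallP => v; apply/implyP => /nou->//.
  have := nou u (connect0 _ _); case: u {nou} => c j.
  by case: (ord3P c) => ->.
by apply/proper_pairP => u v uv; rewrite !PhiE; exact: colour_connect.
Qed.

End Count.

Lemma sum_proper_pairs a b A B :
  (\sum_G proper_colouring a A G * proper_colouring b G B
   = 2 ^ loops a b * proper_colouring (Defs.comp a b) A B)%N.
Proof.
rewrite -card_proper_pairs -sum1dep_card [RHS]big_mkcond /=.
by apply: eq_bigr => G _; rewrite mulnb; case: (_ && _).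
Qed.

Lemma proper_compP a b A B :
  reflect (exists G, proper_colouring a A G /\ proper_colouring b G B)
          (proper_colouring (Defs.comp a b) A B).
Proof.
have := card_proper_pairs a b A B; case: (proper_colouring (Defs.comp a b) A B) => E.
  have : (0 < #|[set G | proper_colouring a A G && proper_colouring b G B]|)%N.
    by rewrite E muln1 expn_gt0.
  move=> /card_gt0P H; constructor; case: H => G.
  by rewrite inE => /andP[aG bG]; exists G.
constructor=> -[G [aG bG]]; move/eqP: E; rewrite muln0 cards_eq0 => /eqP/setP/(_ G).
by rewrite !inE aG bG.
Qed.

(** Give one colour to the edge through [x] and the other colour to the rest: this is proper, so [y]
    lies on that edge. *)
Lemma proper_edge d x y : y != x ->
  (forall A B, proper_colouring d A B -> side_colour A B x = side_colour A B y) ->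
  val d x = y.
Proof.
move=> yx H; pose C (c : bool) := [set i | ((c, i) == x) || ((c, i) == val d x)].
have CE z : side_colour (C false) (C true) z = (z == x) || (z == val d x).
  by case: z => -[] i; rewrite /side_colour inE.
have /H : proper_colouring d (C false) (C true).
  apply/proper_colouringP => z; rewrite !CE (inv_eq (@brauerK d)) orbC.
  by rewrite (inj_eq (inv_inj (@brauerK d))).
by rewrite !CE eqxx /= (negPf yx) => /esym/eqP.
Qed.

Lemma proper_inj a b :
  (forall A B, proper_colouring a A B = proper_colouring b A B) -> a = b.
Proof.
move=> H; apply/val_inj/ffunP => x; apply: proper_edge; first exact: brauerN.
by move=> A B; rewrite H => /proper_colouringP.
Qed.

(* The two products are abstracted: unification would otherwise unfold [loops] and [Defs.comp]. *)
Lemma proper_assoc a b d (ab bd x y : brauer n) l1 l2 l3 l4 :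
  let W := proper_colouring in
  (forall A B, \sum_G W a A G * W b G B = 2 ^ l1 * W ab A B)%N ->
  (forall A B, \sum_G W ab A G * W d G B = 2 ^ l2 * W x A B)%N ->
  (forall A B, \sum_G W b A G * W d G B = 2 ^ l3 * W bd A B)%N ->
  (forall A B, \sum_G W a A G * W bd G B = 2 ^ l4 * W y A B)%N ->
  (l1 + l2 = l3 + l4)%N /\ x = y.
Proof.
move=> W Eab Ex Ebd Ey.
have E A B : (2 ^ (l1 + l2) * W x A B = 2 ^ (l3 + l4) * W y A B)%N.
  rewrite !expnD -!mulnA -Ex -Ey !big_distrr /=.
  transitivity (\sum_G \sum_H W a A H * W b H G * W d G B)%N.
    by apply: eq_bigr => G _; rewrite mulnA -Eab big_distrl.
  rewrite exchange_big /=; apply: eq_bigr => H _.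
  by rewrite mulnCA -Ebd big_distrr /=; apply: eq_bigr => G _; rewrite mulnA.
(* This entry is 1 for every diagram, so it isolates the powers of 2. *)
have W0 c : W c set0 set0.
  by apply/proper_colouringP => -[[] i]; rewrite /side_colour !if_same !inE.
have L : (l1 + l2 = l3 + l4)%N.
  by apply: (@expnI 2) => //; have := E set0 set0; rewrite !W0 !muln1.
split=> //; apply: proper_inj => A B; move: (E A B); rewrite L => /eqP.
by rewrite eqn_pmul2l ?expn_gt0 // /W; do 2!case: proper_colouring.
Qed.

Lemma loops_compA a b d :
  (loops a b + loops (Defs.comp a b) d = loops b d + loops a (Defs.comp b d))%N
  /\ Defs.comp (Defs.comp a b) d = Defs.comp a (Defs.comp b d).
Proof.
exact: proper_assoc (sum_proper_pairs a b) (sum_proper_pairs (Defs.comp a b) d)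
  (sum_proper_pairs b d) (sum_proper_pairs a (Defs.comp b d)).
Qed.

Lemma comp_left_arc a b i j :
  val a (false, i) = (false, j) -> val (Defs.comp a b) (false, i) = (false, j).
Proof.
move=> aij; apply: proper_edge; first by rewrite -aij brauerN.
move=> A B /proper_compP[G [/proper_colouringP/(_ (false, i)) aG _]].
by rewrite aij in aG.
Qed.

Lemma comp_right_arc a b i j :
  val b (true, i) = (true, j) -> val (Defs.comp a b) (true, i) = (true, j).
Proof.
move=> bij; apply: proper_edge; first by rewrite -bij brauerN.
move=> A B /proper_compP[G [_ /proper_colouringP/(_ (true, i)) bG]].
by rewrite bij in bG.
Qed.

(** * Permutation diagrams and their complementary ideal *)

Definition propagating d := [forall x, (val d x).1 != x.1].

(* The two columns carry equally many non-propagating vertices. *)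
Lemma notpropagating_arc d c : ~~ propagating d ->
  exists i j, val d (c, i) = (c, j).
Proof.
move=> nd; have [/existsP[i /eqP ic]|H] := boolP [exists i, (val d (c, i)).1 == c].
  by exists i, (val d (c, i)).2; rewrite -{2}ic -surjective_pairing.
case/negP: nd; apply/forallP.
have dE i : val d (c, i) = (~~ c, (val d (c, i)).2).
  rewrite [LHS]surjective_pairing; congr (_, _).
  move: H; rewrite negb_exists => /forallP/(_ i).
  by move: (val d (c, i)).1 => b; case: b; case: (c).
(* By finiteness the partner map of a fully propagating column is onto the other column. *)
have f_inj : injective (fun i => (val d (c, i)).2).
  move=> i j E; have : val d (c, i) = val d (c, j) by rewrite dE E -dE.
  by move/(inv_inj (@brauerK d)) => -[].
case=> b j; have [->|bc] := eqVneq b c; first by rewrite dE /=; case: (c).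
have -> : (b, j) = val d (c, invF f_inj j).
  by rewrite dE (f_invF f_inj); case: (b) (c) bc => -[].
by rewrite brauerK dE /=; case: (c).
Qed.

(** As [s * t] applies [s] first, joining left [i] to right [s i] turns concatenation into the group
    product, without inversion. *)
Definition perm_diagram_fun (s : 'S_n) : {ffun bvert n -> bvert n} :=
  [ffun x => if x.1 then (false, (s^-1)%g x.2) else (true, s x.2)].

Lemma perm_diagram_proof s : is_brauer (perm_diagram_fun s).
Proof.
by apply/forallP => -[[] i]; rewrite !ffunE /= ?permKV ?permK eqxx.
Qed.

Definition perm_diagram s : brauer n := exist _ (perm_diagram_fun s) (perm_diagram_proof s).

Lemma perm_diagram_inj : injective perm_diagram.
Proof.
move=> s t /(congr1 val)/ffunP E; apply/permP => i.
by have := E (false, i); rewrite !ffunE /= => -[].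
Qed.

Lemma propagating_perm s : propagating (perm_diagram s).
Proof. by apply/forallP => -[[] i]; rewrite ffunE. Qed.

Lemma proper_perm (s : 'S_n) A B :
  reflect (forall i, (i \in A) = (s i \in B)) (proper_colouring (perm_diagram s) A B).
Proof.
apply: (iffP (proper_colouringP _ _ _)) => [H i|H [[] i]].
- by have := H (false, i); rewrite ffunE.
- by rewrite ffunE /side_colour /= H permKV.
- by rewrite ffunE /side_colour /= H.
Qed.

Lemma comp_perm s t :
  Defs.comp (perm_diagram s) (perm_diagram t) = perm_diagram (s * t)%g.
Proof.
apply: proper_inj => A B; apply/proper_compP/proper_perm => [[G [sG tG]] i|H].
  by rewrite permM (proper_perm _ _ _ sG) (proper_perm _ _ _ tG).
exists [set i | t i \in B]; split; apply/proper_perm => i; rewrite inE //.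
by rewrite H permM.
Qed.

(** With [set0] on the left, the middle column must be [set0], so [2 ^ loops] counts at most one
    colouring. *)
Lemma loops_perm s t : loops (perm_diagram s) (perm_diagram t) = 0%N.
Proof.
have := card_proper_pairs (perm_diagram s) (perm_diagram t) set0 set0.
rewrite comp_perm; have -> : proper_colouring (perm_diagram (s * t)%g) set0 set0.
  by apply/proper_perm => i; rewrite !inE.
rewrite muln1 => E; apply/eqP; rewrite -leqn0 -(@leq_exp2l 2) // -E expn0.
rewrite -(cards1 (set0 : {set 'I_n})); apply/subset_leq_card/subsetP => G.
rewrite !inE => /andP[/proper_perm H _]; apply/eqP/setP => i.
by rewrite -(permKV s i) -H !inE.
Qed.

Lemma propagatingP d : reflect (exists s, d = perm_diagram s) (propagating d).
Proof.
apply: (iffP idP) => [/forallP pd|[s ->]]; last exact: propagating_perm.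
have dE i : val d (false, i) = (true, (val d (false, i)).2).
  rewrite [LHS]surjective_pairing; congr (_, _).
  by have := pd (false, i); case: (_.1).
have f_inj : injective (fun i => (val d (false, i)).2).
  move=> i j E; have : val d (false, i) = val d (false, j) by rewrite dE E -dE.
  by move/(inv_inj (@brauerK d)) => -[].
exists (perm f_inj); apply/val_inj/ffunP => -[[] i]; rewrite ffunE /=.
  apply: (inv_inj (@brauerK d)); rewrite brauerK dE.
  by rewrite -(permE f_inj) permKV.
by rewrite permE -dE.
Qed.

(** A left arc of [a] or a right arc of [b] survives in the composite. *)
Lemma propagating_comp a b :
  propagating (Defs.comp a b) = propagating a && propagating b.
Proof.
apply/idP/andP => [pab|[/propagatingP[s ->] /propagatingP[t ->]]]; last first.
  by rewrite comp_perm propagating_perm.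
split; apply: contraTT pab => /notpropagating_arc.
  case/(_ false)=> i [j /(@comp_left_arc a b) E].
  by apply/forallPn; exists (false, i); rewrite E.
case/(_ true)=> i [j /(@comp_right_arc a b) E].
by apply/forallPn; exists (true, i); rewrite E.
Qed.

Definition perm_of_diagram d : 'S_n := odflt 1%g [pick s | perm_diagram s == d].

Lemma perm_diagramK : cancel perm_diagram perm_of_diagram.
Proof.
move=> s; rewrite /perm_of_diagram; case: pickP => [t /eqP/perm_diagram_inj//|/(_ s)].
by rewrite eqxx.
Qed.

Lemma perm_of_diagramK d : propagating d -> perm_diagram (perm_of_diagram d) = d.
Proof. by case/propagatingP=> s ->; rewrite perm_diagramK. Qed.

(** * Right ideals of diagrams with prescribed left arcs *)

Definition has_left_arcs (S : seq ('I_n * 'I_n)) d :=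
  all (fun p => val d (false, p.1) == (false, p.2)) S.

Lemma has_left_arcs_comp S a b : has_left_arcs S a -> has_left_arcs S (Defs.comp a b).
Proof.
move/allP=> aS; apply/allP => p /aS/eqP pa; apply/eqP; exact: comp_left_arc.
Qed.

Section ArcIdempotent.
Variables (S : seq ('I_n * 'I_n)) (d0 : brauer n).
Hypothesis Sd0 : has_left_arcs S d0.

Let supp i := has (fun p => (p.1 == i) || (p.2 == i)) S.

Let suppP i : supp i -> exists j, supp j /\
  forall d, has_left_arcs S d -> val d (false, i) = (false, j).
Proof.
case/hasP=> p pS /orP[]/eqP<-; [exists p.2|exists p.1].
  split=> [|d /allP/(_ p pS)/eqP//].
  by apply/hasP; exists p => //; rewrite eqxx orbT.
split=> [|d /allP/(_ p pS)/eqP <-]; last by rewrite brauerK.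
by apply/hasP; exists p => //; rewrite eqxx.
Qed.

(** The arcs of [S] in both columns and horizontal edges elsewhere, with partners read off from
    [d0]. It is idempotent up to a power of the parameter. *)
Definition arc_idempotent_fun : {ffun bvert n -> bvert n} :=
  [ffun x => if supp x.2 then (x.1, (val d0 (false, x.2)).2) else (~~ x.1, x.2)].

Lemma arc_idempotent_proof : is_brauer arc_idempotent_fun.
Proof.
apply/forallP => -[b i]; rewrite !ffunE /=.
have [si|nsi] := boolP (supp i); last first.
  by rewrite /= (negPf nsi) negbK eqxx andbT; case: b.
have [j [sj /(_ _ Sd0) ij]] := suppP si; rewrite ij /= sj.
have ji : val d0 (false, j) = (false, i) by rewrite -ij brauerK.
by rewrite ji eqxx andbT; apply/eqP => -[E]; have := brauerN d0 (false, i); rewrite ij E eqxx.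
Qed.

Definition arc_idempotent : brauer n := exist _ arc_idempotent_fun arc_idempotent_proof.

Lemma has_left_arcs_idempotent : has_left_arcs S arc_idempotent.
Proof.
apply/allP => p pS; rewrite ffunE /=.
have -> : supp p.1 by apply/hasP; exists p => //; rewrite eqxx.
by rewrite (eqP (allP Sd0 p pS)).
Qed.

(** Horizontal edges force a middle colouring [G] to agree with [A] off the support of [S]; on the
    support both diagrams have the same left arcs. Conversely [G = A] works. *)
Lemma comp_arc_idempotent d : has_left_arcs S d -> Defs.comp arc_idempotent d = d.
Proof.
move=> Sd; apply: proper_inj => A B.
apply/proper_compP/idP => [[G [/proper_colouringP eG /proper_colouringP dG]]|dA].
  have AG x : ~~ (~~ x.1 && supp x.2) -> side_colour A B x = side_colour G B x.
    case: x => -[] i //= nsi.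
    by have := eG (false, i); rewrite ffunE /= (negPf nsi).
  apply/proper_colouringP => x; have [|nx] := boolP (~~ x.1 && supp x.2).
    case: x => -[] i //= si; have [j [sj jE]] := suppP si.
    by have := eG (false, i); rewrite ffunE /= si !jE.
  rewrite (AG x) // AG ?dG //; apply: contra nx; rewrite -{3 4}(brauerK d x).
  case: (val d x) => -[] i //= si; have [j [sj jE]] := suppP si.
  by rewrite jE.
exists A; split=> //; apply/proper_colouringP => -[b i]; rewrite ffunE /=.
have [si|nsi] := boolP (supp i); last by rewrite /side_colour /= !if_same.
have [j [_ jE]] := suppP si.
have := proper_colouringP _ _ _ dA (false, i); rewrite !jE // /side_colour /=.
by rewrite !if_same.
Qed.

(** Writing [e] for the arc idempotent, compare loop counts in [(e e) d = e (e d)], reduce by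
    [e e = e] and [e d = d] as diagrams, and cancel [loops e d]. *)
Lemma loops_arc_idempotent d : has_left_arcs S d ->
  loops arc_idempotent d = loops arc_idempotent arc_idempotent.
Proof.
move=> Sd; have [] := loops_compA arc_idempotent arc_idempotent d.
rewrite !comp_arc_idempotent //; last exact: has_left_arcs_idempotent.
by move=> /addIn.
Qed.

End ArcIdempotent.

End Composition.

(** Every non-propagating diagram has a left arc, so these diagrams are the union of the ideals of
    single arcs. A nonempty ideal is contracted by its arc idempotent, whose scalar is a power of
    [delta]. *)
Lemma right_acyclic_notpropagating (k : comPzRingType) n (delta delta' : k) :
  delta' * delta = 1 ->
  right_acyclic (@brauer_mul k n delta) (@brauer_aug k n) (predC (@propagating n)).
Proof.
move=> dK; have compA a b d := (@loops_compA n a b d).2.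
have augN a : ~~ propagating a -> brauer_aug k a = 0.
  by rewrite /brauer_aug -/(propagating a) => /negPf->.
pose r := [seq [:: p] | p <- enum {: 'I_n * 'I_n}].
apply: (@eq_right_acyclic _ _ _ _ (fun d => has ((@has_left_arcs n)^~ d) r)).
  move=> d /=; apply/hasP/idP => [[_ /mapP[p _ ->]]|/(notpropagating_arc false)[i [j ij]]].
    by rewrite /has_left_arcs /= andbT => /eqP E; apply/forallPn; exists (false, p.1); rewrite E.
  exists [:: (i, j)]; last by rewrite /has_left_arcs /= ij eqxx.
  by apply/mapP; exists (i, j); rewrite // mem_enum.
apply: right_acyclic_has.
- move=> a b; rewrite /brauer_aug -!/(propagating _) /= propagating_comp.
  have [/propagatingP[s ->]|_] := boolP (propagating a); last by rewrite mul0r mulr0.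
  have [/propagatingP[t ->]|_] := boolP (propagating b); last by rewrite !mulr0.
  by rewrite loops_perm expr0.
- exact: compA.
- by move=> a b d; rewrite /= -!exprD (loops_compA a b d).1.
- by move=> S T d; rewrite /has_left_arcs all_cat.
- move=> S S0; split.
    split=> [d Sd|d a]; last exact: has_left_arcs_comp.
    apply: augN; case: S S0 Sd => // p S _ /andP[/eqP pd _].
    by apply/forallPn; exists (false, p.1); rewrite pd.
  have [d0 Sd0|nS] := pickP (has_left_arcs S); last first.
    by apply: (eq_right_acyclic (X := pred0)); [move=> d; rewrite nS | exact: right_acyclic0].
  pose e := arc_idempotent Sd0.
  apply: (@right_acyclic_unit _ _ _ _ _ e (delta ^+ loops e e) (delta' ^+ loops e e)).
  + exact: has_left_arcs_idempotent.
  + by rewrite -exprMn dK expr1n.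
  + move=> d Sd; rewrite /brauer_mul /e (comp_arc_idempotent Sd0 Sd).
    rewrite (loops_arc_idempotent Sd0 Sd); exact: erefl.
- by apply/allP => _ /mapP[p _ ->].
Qed.

Theorem theorem7p9 (k : comPzRingType) (n : nat) (delta : k) :
  (0 < n)%N -> (exists delta' : k, delta * delta' = 1 /\ delta' * delta = 1) ->
  forall p : nat, @ext_brauer_iso_group_cohom k n delta p.
Proof.
move=> _ [delta' [_ dK]] p.
apply: (@quotient_cohom_iso k (brauer n) (@brauer_mul k n delta) (@propagating n)
  _ _ _ _ _ 'S_n (@sym_mul k n) (@perm_diagram n) (@perm_of_diagram n)).
- by move=> a b; exact: propagating_comp.
- exact: right_acyclic_notpropagating dK.
- by move=> a b d; exact: (loops_compA a b d).2.
- by move=> a b d; rewrite /= -!exprD (loops_compA a b d).1.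
- by move=> a b /propagatingP[s ->] /propagatingP[t ->]; rewrite /= loops_perm expr0.
- exact: perm_diagramK.
- exact: perm_of_diagramK.
- exact: propagating_perm.
- by move=> s t; rewrite /= comp_perm perm_diagramK.
Qed.
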